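(* Consider the regular partially labeled $k$-label broadcasting tree $\text{Tree}_k(\theta,d,\delta)$ (see context), and for $i\in[k]$ let $\mu^{(i)}_{\ell_{T_{\leq t}(\rho)}}$ be the distribution of the revealed labels $\ell_{T_{\leq t}(\rho)}$ conditionally on $\ell(\rho)=i$. Assume $\delta d>1$, $(1-\delta)\theta^2d<\frac14$, and $$2\delta d\log\Big(1+\theta^2\Big(\frac{1}{\theta+\frac{1-\theta}{k}}+\frac{1}{\frac{1-\theta}{k}}\Big)\Big)<[1-4(1-\delta)\theta^2d]^2.$$ Then for any $t>0$, $$\max_{i,j\in[k]}\log\Big(1+d_{\chi^2}\big(\mu^{(i)}_{\ell_{T_{\leq t}(\rho)}},\mu^{(j)}_{\ell_{T_{\leq t}(\rho)}}\big)\Big)\leq\frac{2\delta d\log\Big(1+\theta^2\Big(\frac{1}{\theta+\frac{1-\theta}{k}}+\frac{1}{\frac{1-\theta}{k}}\Big)\Big)}{1-4(1-\delta)\theta^2d}\leq k\cdot\frac{2\delta\theta^2d}{1-4(1-\delta)\theta^2d}\Big(\frac{1}{1-\theta}+\frac{1}{k\theta+1-\theta}\Big).$$ Furthermore, $$\inf_\Phi\sup_{\ell(\rho)\in[k]}\mathbb{P}\big(\Phi(\ell_{T_{\leq t}(\rho)})\neq\ell(\rho)\big)\geq\frac12\Big(1-\frac{2\delta\theta^2d}{1-4(1-\delta)\theta^2d}\Big(\frac{1}{1-\theta}+\frac{1}{k\theta+1-\theta}\Big)-\frac1k\Big),$$ where the infimum is over all estimators $\Phi$ mapping the revealed labels to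 $[k]$.
   Context: $\text{Tree}_k(\theta,d,\delta)$ (regular version): every vertex has $d$ children, exactly $\delta d$ with revealed labels and $(1-\delta)d$ unlabeled; labels in $[k]=\{1,\dots,k\}$; the root label is unrevealed; each child independently copies its parent's label with probability $\theta+\frac{1-\theta}{k}$ and takes each of the other $k-1$ labels with probability $\frac{1-\theta}{k}$, $0<\theta<1$. $\ell_{T_{\leq t}(\rho)}$ is the collection of revealed labels at depth $\leq t$. $d_{\chi^2}(\mu,\nu)=\int\frac{\mu^2}{\nu}-1$ is the $\chi^2$ divergence. *)

(* Defs.v *)
From HB Require Import structures.
From mathcomp Require Import all_boot all_order all_algebra.
From mathcomp Require Import reals exp.
Set Implicit Arguments. Unset Strict Implicit. Unset Printing Implicit Defensive.
Import Order.TTheory GRing.Theory Num.Theory.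
Local Open Scope ring_scope.

(* Vertices of the d-ary tree truncated at depth t: a vertex at depth n is
   the n-tuple of child indices on the path from the root. *)
Notation Vtx d t := {n : 'I_t.+1 & n.-tuple 'I_d}.

Definition vseq (d t : nat) (v : Vtx d t) : seq 'I_d := tagged v.

Definition root (d t : nat) : Vtx d t :=
  existT (fun n : 'I_t.+1 => n.-tuple 'I_d) ord0 [tuple].

Definition is_parent (d t : nat) (u v : Vtx d t) : bool :=
  (0 < size (vseq v))%N && (vseq u == take (size (vseq v)).-1 (vseq v)).

(* Among the d children of every vertex, the first m (= delta d) have
   revealed labels; the root is unrevealed. *)
Definition revealed (d t m : nat) (v : Vtx d t) : bool :=
  if rev (vseq v) is c :: _ then (c < m)%N else false.

Definition trans (R : realType) (k : nat) (theta : R) (a b : 'I_k) : R :=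
  if a == b then theta + (1 - theta) / k%:R else (1 - theta) / k%:R.

(* Probability weight of a full labeling (root label fixed separately). *)
Definition weight (R : realType) (k d t : nat) (theta : R)
  (sigma : {ffun Vtx d t -> 'I_k}) : R :=
  \prod_(u : Vtx d t) \prod_(v : Vtx d t | is_parent u v)
     trans theta (sigma u) (sigma v).

Definition obs (d t m k : nat) (sigma : {ffun Vtx d t -> 'I_k})
  : {ffun Vtx d t -> option 'I_k} :=
  [ffun v => if revealed m v then Some (sigma v) else None].

Definition mu (R : realType) (k d t m : nat) (theta : R) (i : 'I_k)
  (x : {ffun Vtx d t -> option 'I_k}) : R :=
  \sum_(sigma : {ffun Vtx d t -> 'I_k} |
          (sigma (root d t) == i) && (obs m sigma == x))
     weight theta sigma.

Definition chi2 (R : realType) (X : finType) (p q : X -> R) : R :=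
  \sum_(x : X) p x ^+ 2 / q x - 1.

Definition err (R : realType) (k d t m : nat) (theta : R)
  (Phi : {ffun Vtx d t -> option 'I_k} -> 'I_k) (i : 'I_k) : R :=
  \sum_(x : {ffun Vtx d t -> option 'I_k})
     mu m theta i x * (Phi x != i)%:R.

(* Main.v *)
(* Write S_t(i, j) = 1 + chi2(mu_i, mu_j) on the tree of depth t. Given the root
   label the d subtrees are independent, so S_(t+1) is a product over the
   children. A revealed child contributes at most
   1 + chi2(trans i, trans j) = e^L, because its label screens off its subtree.
   An unlabeled child contributes the factor of two mixtures of the mu_l, which
   differ by theta (mu_i - mu_j); convexity of 1/x in the denominator and
   (u - v)^2 <= 2 u^2 + 2 v^2 bound it by 1 + 4 theta^2 (max S_t - 1). Hence
   log S_(t+1) <= m L + (1 - D)(max S_t - 1), and y = 2 m L / D satisfies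
   m L + (1 - D)(e^y - 1) <= y as soon as y < D.
   For the estimation bound, y < 1 gives chi2 <= 2 y, and each success
   probability is compared with that of a fixed hypothesis. *)
Require Import Defs.
From HB Require Import structures.
From mathcomp Require Import all_boot all_order all_algebra.
From mathcomp Require Import reals exp.
From mathcomp Require Import classical_sets topology normedtype derive sequences.
From mathcomp Require Import ring lra.
Set Implicit Arguments. Unset Strict Implicit. Unset Printing Implicit Defensive.
Import Order.TTheory GRing.Theory Num.Theory.
Import numFieldNormedType.Exports.
Local Open Scope ring_scope.

(** * Exponential bound, chi-square inequalities and estimation error *)

(** The cubic coefficient 1/2, in place of 1/6, absorbs the rest of the exponential series on
    [0, 1]. *)
Lemma expR_le_cubic (R : realType) (y : R) : 0 <= y <= 1 ->
  expR y <= 1 + y + y ^+ 2 / 2 + y ^+ 3 / 2.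
Proof.
case/andP; rewrite le_eqVlt => /predU1P[<- _|y0 y1].
  by rewrite expR0 !expr0n /= !mul0r !addr0.
(* (1 + x + x^2/2 + x^3/2) e^(-x) is nondecreasing on [0, 1]. *)
pose q : {poly R} := 1 + 'X + 2^-1 *: 'X^2 + 2^-1 *: 'X^3.
pose g := (fun x : R => q.[x] * expR (- x)).
pose g' := (fun x : R => (q^`().[x] - q.[x]) * expR (- x)).
have dg (x : R) : is_derive x 1 g (g' x).
  have dq : is_derive x 1 (horner q) q^`().[x].
    by rewrite derivE derive1E; apply/derivableP/derivable_horner.
  by rewrite /g /g'; apply: is_derive_eq; rewrite /GRing.scale /=; ring.
have cg : {within `[0, y]%classic, continuous g}%classic.
  apply: continuous_subspaceT => x.
  by apply/differentiable_continuous/derivable1_diffP/ex_derive.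
have [c] := MVT y0 (fun x _ => dg x) cg.
rewrite in_itv /= => /andP[c0 cy] gE.
have g'0 : 0 <= g' c.
  rewrite mulr_ge0 ?expR_ge0 // /q !poly.derivE !hornerE /=.
  (* The derivative of [q] minus [q] is [x^2 (1 - x / 2)]. *)
  have : 0 <= c ^+ 2 * (1 - c / 2) by rewrite mulr_ge0 ?sqr_ge0 //; lra.
  lra.
have : g 0 <= g y by rewrite -subr_ge0 gE mulr_ge0 // subr0 ltW.
rewrite /g oppr0 expR0 mulr1 expRN ler_pdivlMr ?expR_gt0 // /q !hornerE /=.
by rewrite !(mulr0, addr0, mul1r) => /le_trans; apply; lra.
Qed.

(* Titu's form of the Cauchy-Schwarz inequality; the second hypothesis covers
   the terms where Rocq's division by 0 gives 0. *)
Lemma sqr_sum_div_le (R : realFieldType) (I : finType) (P : pred I)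
  (a b : I -> R) : (forall i, P i -> 0 <= b i) ->
  (forall i, P i -> b i = 0 -> a i = 0) ->
  (\sum_(i | P i) a i) ^+ 2 / (\sum_(i | P i) b i)
    <= \sum_(i | P i) a i ^+ 2 / b i.
Proof.
move=> b0 ab; set A := \sum_(i | P i) a i; set B := \sum_(i | P i) b i.
have [B0|BN] := eqVneq B 0.
  rewrite B0 invr0 mulr0; apply: sumr_ge0 => i Pi.
  by rewrite divr_ge0 ?sqr_ge0 ?b0.
(* With [t = A / B], each term [2 t a - t^2 b] is a tangent lower bound of [a^2 / b], because
   [(a - t b)^2 >= 0]. *)
have -> : A ^+ 2 / B
    = \sum_(i | P i) (2 * (A / B) * a i - (A / B) ^+ 2 * b i).
  rewrite sumrB -!mulr_sumr -/A -/B; field; exact: BN.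
apply: ler_sum => i Pi; have [bi0|biN] := eqVneq (b i) 0.
  by rewrite (ab _ Pi bi0) bi0 !mulr0 subr0 expr0n mul0r.
have bi_gt0 : 0 < b i by rewrite lt_neqAle eq_sym biN b0.
rewrite ler_pdivlMr //.
have := sqr_ge0 (a i - A / B * b i); nra.
Qed.

(** The centred form makes nonnegativity visible and involves the numerator only through [p - q],
    which mixing contracts by [theta]. *)
Lemma sum_sqr_sub_div (R : realType) (X : finType) (p q : X -> R) :
  (forall x, q x = 0 -> p x = 0) -> \sum_x p x = 1 -> \sum_x q x = 1 ->
  \sum_x (p x - q x) ^+ 2 / q x = chi2 p q.
Proof.
move=> ac p1 q1.
have E x : (p x - q x) ^+ 2 / q x = p x ^+ 2 / q x - 2 * p x + q x.
  have [qx|qx] := eqVneq (q x) 0; last by field.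
  by rewrite qx ac // !invr0 !mulr0 subr0 addr0.
rewrite (eq_bigr _ (fun x _ => E x)) big_split /= sumrB -mulr_sumr p1 q1.
by rewrite /chi2; ring.
Qed.

(* With v the indicator of A, this bounds sum_x (p - q)(v - q(A)) by AM-GM,
   which yields the sharp variance term q(A)(1 - q(A)). *)
Lemma event_gap_le (R : realType) (X : finType) (p q : X -> R)
  (A : pred X) (s : R) :
  (forall x, 0 <= q x) -> (forall x, q x = 0 -> p x = 0) ->
  \sum_x p x = 1 -> \sum_x q x = 1 -> 0 < s ->
  \sum_(x | A x) p x <= \sum_(x | A x) q x + s / 2 * chi2 p q
    + (\sum_(x | A x) q x) * (1 - \sum_(x | A x) q x) / (2 * s).
Proof.
move=> q0 ac p1 q1 s0; set qA := \sum_(x | A x) q x.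
pose v x : R := (A x)%:R.
have sv (f : X -> R) : \sum_x f x * v x = \sum_(x | A x) f x.
  rewrite [RHS]big_mkcond; apply: eq_bigr => x _.
  by rewrite /v; case: (A x); rewrite ?mulr1 ?mulr0.
have vv x : v x ^+ 2 = v x by rewrite /v; case: (A x); rewrite ?expr1n ?expr0n.
have E1 : \sum_x (p x - q x) * (v x - qA) = \sum_(x | A x) p x - qA.
  under eq_bigr => x _ do rewrite mulrBr !mulrBl.
  by rewrite !sumrB !sv -!mulr_suml p1 q1 !mul1r subrr subr0.
have E2 : \sum_x q x * (v x - qA) ^+ 2 = qA * (1 - qA).
  rewrite (eq_bigr (fun x => (1 - 2 * qA) * (q x * v x) + qA ^+ 2 * q x)).
    by rewrite big_split /= -!mulr_sumr sv q1 -/qA; ring.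
  move=> x _; rewrite sqrrB vv; ring.
have : \sum_x (p x - q x) * (v x - qA)
    <= s / 2 * chi2 p q + qA * (1 - qA) / (2 * s).
  rewrite -E2 -(sum_sqr_sub_div ac p1 q1) mulr_sumr mulr_suml -big_split /=.
  apply: ler_sum => x _; have [qx0|qxN] := eqVneq (q x) 0.
    by rewrite ac // qx0 !(mul0r, subr0, invr0, mulr0, addr0).
  have qx : 0 < q x by rewrite lt_neqAle eq_sym qxN q0.
  have -> : s / 2 * ((p x - q x) ^+ 2 / q x) + q x * (v x - qA) ^+ 2 / (2 * s)
    = (p x - q x) * (v x - qA)
      + (s * (p x - q x) - q x * (v x - qA)) ^+ 2 / (2 * s * q x).
    by field; rewrite gt_eqF //= gt_eqF.
  by rewrite lerDl divr_ge0 ?sqr_ge0 // !mulr_ge0 ?ltW.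
rewrite E1; lra.
Qed.

(** The events [Phi x == i] partition [X], so their probabilities under the fixed law [P ord0] sum
    to 1; the chi-square bound limits how far the success probabilities can exceed these. *)
Lemma sum_error_ge (R : realType) (X : finType) (k : nat) (y : R)
  (P : 'I_k -> X -> R) (Phi : X -> 'I_k) :
  (0 < k)%N -> 0 <= y <= 1 -> (forall i x, 0 <= P i x) ->
  (forall i, \sum_x P i x = 1) -> (forall i j x, P j x = 0 -> P i x = 0) ->
  (forall i j, chi2 (P i) (P j) <= 2 * y) ->
  (k%:R - 1 - y) / 2 <= \sum_i \sum_x P i x * (Phi x != i)%:R.
Proof.
case: k P Phi => // n P Phi _ /andP[y0 y1] P0 P1 ac chi.
have err_ge0 : 0 <= \sum_i \sum_x P i x * (Phi x != i)%:R.
  by apply: sumr_ge0 => i _; apply: sumr_ge0 => x _; rewrite mulr_ge0.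
case: n P Phi P0 P1 ac chi err_ge0 => [|n] P Phi P0 P1 ac chi err_ge0.
  (* For [k = 1] the claimed bound is [- y / 2]. *)
  by apply: le_trans err_ge0; lra.
pose p i := \sum_(x | Phi x == i) P i x.
pose q i := \sum_(x | Phi x == i) P ord0 x.
have errE i : \sum_x P i x * (Phi x != i)%:R = 1 - p i.
  rewrite -[in RHS](P1 i) [in RHS](bigID (fun x => Phi x == i)) /= -/(p i).
  rewrite [p i + _]addrC addrK [RHS]big_mkcond; apply: eq_bigr => x _.
  by case: (Phi x == i); rewrite ?mulr1 ?mulr0.
have q1 : \sum_i q i = 1.
  by rewrite -(P1 ord0) (partition_big Phi predT).
have q0 i : 0 <= q i by apply: sumr_ge0.
rewrite (eq_bigr _ (fun i _ => errE i)) sumrB big_const_ord iter_addr_0.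
(* Applying the gap bound with s = 1/M and q(1 - q) <= q(1 - 2/M) + 1/M^2 is
   sharp enough when M = k - 1, except that k = 2 needs M = 2. *)
have [M M2 Mk] : exists2 M : R, 2 <= M &
    n.+1%:R * (y / M + M^-1 / 2) + M / 2 <= (n.+2%:R + 1 + y) / 2.
  case: n {P Phi P0 P1 ac chi err_ge0 p q errE q1 q0} => [|n].
    by exists 2; lra.
  exists n.+2%:R; first by rewrite ler_nat.
  have nN : n.+2%:R != 0 :> R by rewrite pnatr_eq0.
  rewrite (_ : _ * _ = y + 1 / 2); last first.
    by move: (n.+2%:R : R) nN => N N0; field.
  rewrite -[n.+3%:R]natr1.
  by move: (n.+2%:R : R) => N; lra.
have step i : p i <= q i + y / M + (q i * (M - 2) + M^-1) / 2.
  have Mi : 0 < M^-1 by rewrite invr_gt0; lra.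
  have := event_gap_le (fun x => Phi x == i) (P0 ord0) (ac i ord0)
    (P1 i) (P1 ord0) Mi.
  rewrite /= -/(p i) -/(q i) => /le_trans; apply; rewrite -!addrA lerD2l.
  have -> : q i * (1 - q i) / (2 * M^-1)
      = (q i * (M - 2) + M^-1) / 2 - M / 2 * (q i - M^-1) ^+ 2.
    by field; lra.
  have sq : 0 <= M / 2 * (q i - M^-1) ^+ 2.
    by rewrite mulr_ge0 ?sqr_ge0 //; lra.
  have ch : M^-1 / 2 * chi2 (P i) (P ord0) <= M^-1 / 2 * (2 * y).
    by rewrite ler_wpM2l ?chi // divr_ge0 // ltW.
  lra.
have qs : \sum_(i < n.+1) q (lift ord0 i) <= 1.
  by rewrite -[leRHS]q1 [leRHS]big_ord_recl lerDr.
have : \sum_i p i <= 1 + n.+1%:R * (y / M + M^-1 / 2) + (M - 2) / 2.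
  (* The reference hypothesis [ord0] has no gap to pay, which leaves [k - 1] gaps. *)
  rewrite big_ord_recl.
  have -> : p ord0 = q ord0 by [].
  have : \sum_(i < n.+1) p (lift ord0 i) <= \sum_(i < n.+1)
      (q (lift ord0 i) + y / M + (q (lift ord0 i) * (M - 2) + M^-1) / 2).
    by apply: ler_sum => i _; exact: step.
  rewrite !big_split /= -!mulr_suml big_split /= -!mulr_suml !sumr_const card_ord.
  have : q ord0 + \sum_(i < n.+1) q (lift ord0 i) = 1.
    by rewrite -[RHS]q1 [RHS]big_ord_recl.
  have : (\sum_(i < n.+1) q (lift ord0 i)) * (M - 2) <= 1 * (M - 2).
    by apply: ler_wpM2r => //; lra.
  rewrite -[y *+ _]mulr_natl -[M^-1 *+ _]mulr_natl.
  move: (n.+1%:R : R) (\sum_(i < n.+1) p _) (\sum_(i < n.+1) q _) => N u w.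
  lra.
move: Mk.
move: (n.+1%:R : R) (n.+2%:R : R) (\sum_i p i) => N K u; lra.
Qed.

(** * The tree of depth t + 1 as a root with d subtrees *)

Lemma vseq_inj (d t : nat) : injective (@vseq d t).
Proof.
move=> [[n ln] u] [[n' ln'] v]; rewrite /vseq /= => uv.
have nn' : n = n' by move: (size_tuple u); rewrite uv size_tuple.
case: n' / nn' in ln' v uv *; rewrite (bool_irrelevance ln' ln).
by congr existT; apply: val_inj.
Qed.

(** Embeds the tree of depth [t] as the subtree hanging from child [c] of the root. *)
Definition vcons (d t : nat) (c : 'I_d) (v : Vtx d t) : Vtx d t.+1 :=
  existT (fun n : 'I_t.+2 => n.-tuple 'I_d)
    (lift ord0 (tag v)) [tuple of c :: tagged v].

Lemma vseq_vcons (d t : nat) (c : 'I_d) (v : Vtx d t) :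
  vseq (vcons c v) = c :: vseq v.
Proof. by []. Qed.

Lemma vcons_inj (d t : nat) (c c' : 'I_d) (v v' : Vtx d t) :
  vcons c v = vcons c' v' -> (c, v) = (c', v').
Proof. by move/(congr1 (@vseq d t.+1)) => [-> /vseq_inj ->]. Qed.

Lemma eq_root (d t : nat) (v : Vtx d t) : (v == Defs.root d t) = (vseq v == [::]).
Proof. by apply/eqP/eqP => [->|vn] //; apply: vseq_inj. Qed.

Lemma vtxS_case (d t : nat) (v : Vtx d t.+1) :
  v = Defs.root d t.+1 \/ exists c w, v = vcons c w.
Proof.
have [->|] := eqVneq v (Defs.root d t.+1); first by left.
rewrite eq_root; case E: (vseq v) => [//|c s] _; right; exists c.
have st : (size s < t.+1)%N.
  have : (size (vseq v) < t.+2)%N by rewrite /vseq size_tuple.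
  by rewrite E.
exists (existT (fun n : 'I_t.+1 => n.-tuple 'I_d) (Ordinal st) (in_tuple s)).
by apply: vseq_inj; rewrite vseq_vcons E.
Qed.

(** Inverting [vcons] by search avoids transport along the length of a dependent tuple. *)
Definition uncons (d t : nat) (v : Vtx d t.+1) : option ('I_d * Vtx d t) :=
  [pick cw | v == vcons cw.1 cw.2].

Lemma uncons_root (d t : nat) : uncons (Defs.root d t.+1) = None.
Proof.
by rewrite /uncons; case: pickP => // -[c w] /eqP /(congr1 (@vseq d t.+1)).
Qed.

Lemma uncons_vcons (d t : nat) (c : 'I_d) (v : Vtx d t) :
  uncons (vcons c v) = Some (c, v).
Proof.
rewrite /uncons; case: pickP => [[c' w] /eqP /vcons_inj /= <- //|].
by move/(_ (c, v)); rewrite eqxx.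
Qed.

Lemma big_vtxS (R : Type) (idx : R) (op : Monoid.com_law idx) (d t : nat)
  (F : Vtx d t.+1 -> R) :
  \big[op/idx]_v F v
    = op (F (Defs.root d t.+1)) (\big[op/idx]_c \big[op/idx]_w F (vcons c w)).
Proof.
rewrite (bigD1 (Defs.root d t.+1)) //=; congr (op _ _); rewrite pair_bigA /=.
rewrite (reindex_omap (fun cw => vcons cw.1 cw.2) (@uncons d t)) /=.
  by by apply: eq_bigl => -[c w] /=; rewrite uncons_vcons eqxx.
move=> v; case: (vtxS_case v) => [->|[c [w ->]] _]; first by rewrite eqxx.
by rewrite uncons_vcons.
Qed.

Lemma is_parent_root (d t : nat) (u : Vtx d t) : is_parent u (Defs.root d t) = false.
Proof. by []. Qed.

Lemma is_parent_root_vcons (d t : nat) (c : 'I_d) (v : Vtx d t) :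
  is_parent (Defs.root d t.+1) (vcons c v) = (v == Defs.root d t).
Proof. by rewrite /is_parent vseq_vcons eq_root /=; case: (vseq v). Qed.

Lemma is_parent_vcons (d t : nat) (c c' : 'I_d) (u v : Vtx d t) :
  is_parent (vcons c u) (vcons c' v) = (c == c') && is_parent u v.
Proof.
rewrite /is_parent !vseq_vcons /=; case: (vseq v) => [|x s] /=.
  by rewrite andbF.
by rewrite eqseq_cons.
Qed.

(** Revelation depends on the last index of a path, so a prepended [c] matters only when the path
    was empty. *)
Lemma revealed_vcons (d t m : nat) (c : 'I_d) (v : Vtx d t) :
  revealed m (vcons c v) = if v == Defs.root d t then (c < m)%N else revealed m v.
Proof.
rewrite /revealed vseq_vcons eq_root rev_cons.
case: (lastP (vseq v)) => [//|s x]; rewrite rev_rcons /=.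
by case: s.
Qed.

(** Glues a root value to one labeling per subtree; every labeling of the taller tree arises
    uniquely in this way. *)
Definition graft (A : Type) (d t : nat) (a : A)
  (f : {ffun 'I_d -> {ffun Vtx d t -> A}}) : {ffun Vtx d t.+1 -> A} :=
  [ffun v => if uncons v is Some cw then f cw.1 cw.2 else a].

Lemma graft_root (A : Type) (d t : nat) (a : A)
  (f : {ffun 'I_d -> {ffun Vtx d t -> A}}) : graft a f (Defs.root d t.+1) = a.
Proof. by rewrite ffunE uncons_root. Qed.

Lemma graft_vcons (A : Type) (d t : nat) (a : A)
  (f : {ffun 'I_d -> {ffun Vtx d t -> A}}) (c : 'I_d) (v : Vtx d t) :
  graft a f (vcons c v) = f c v.
Proof. by rewrite ffunE uncons_vcons. Qed.

Lemma ffun_vtxS_ext (A : Type) (d t : nat) (f g : {ffun Vtx d t.+1 -> A}) :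
  f (Defs.root d t.+1) = g (Defs.root d t.+1) ->
  (forall c v, f (vcons c v) = g (vcons c v)) -> f = g.
Proof.
by move=> fg0 fg; apply/ffunP => v; case: (vtxS_case v) => [->|[c [w ->]]].
Qed.

Lemma eq_graft (A : eqType) (d t : nat) (a b : A)
  (f g : {ffun 'I_d -> {ffun Vtx d t -> A}}) :
  (graft a f == graft b g) = (a == b) && (f == g).
Proof.
apply/eqP/andP => [fg|[/eqP -> /eqP ->] //]; split; apply/eqP.
  by rewrite -(graft_root a f) fg graft_root.
apply/ffunP => c; apply/ffunP => v.
by rewrite -(graft_vcons a f) fg graft_vcons.
Qed.

Lemma sum_graft (R : nmodType) (A : finType) (d t : nat)
  (F : {ffun Vtx d t.+1 -> A} -> R) :
  \sum_s F s = \sum_a \sum_f F (graft a f).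
Proof.
rewrite pair_bigA /= (reindex (fun af => graft af.1 af.2)) //=.
exists (fun s => (s (Defs.root d t.+1), [ffun c => [ffun v => s (vcons c v)]])).
  move=> [a f] _ /=; rewrite graft_root; congr pair.
  by apply/ffunP => c; apply/ffunP => v; rewrite !ffunE uncons_vcons.
move=> s _ /=; apply: ffun_vtxS_ext; first by rewrite graft_root.
by move=> c v; rewrite graft_vcons !ffunE.
Qed.

(** * Factorization of weights and observed laws over the children *)

Lemma prod_if (R : comPzRingType) (I : finType) (b : pred I) (F : I -> R) :
  \prod_i (if b i then F i else 0) = if [forall i, b i] then \prod_i F i else 0.
Proof.
case: forallP => [bT|/forallP]; first by apply: eq_bigr => i _; rewrite bT.
rewrite negb_forall => /existsP[i /negbTE bi].
by rewrite (bigD1 i) //= bi mul0r.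
Qed.

(** An edge either joins the root to a child or stays inside one subtree. *)
Lemma weight_graft (R : realType) (k d t : nat) (theta : R) (a : 'I_k)
  (f : {ffun 'I_d -> {ffun Vtx d t -> 'I_k}}) :
  weight theta (graft a f)
    = \prod_c (trans theta a (f c (Defs.root d t)) * weight theta (f c)).
Proof.
rewrite /weight big_vtxS big_split /=; congr (_ * _).
  rewrite big_mkcond big_vtxS /= mul1r.
  apply: eq_bigr => c _; rewrite -big_mkcond (big_pred1 (Defs.root d t)) /=.
    by rewrite graft_root graft_vcons.
  by move=> v; rewrite is_parent_root_vcons.
apply: eq_bigr => c _; apply: eq_bigr => u _.
rewrite big_mkcond big_vtxS /= mul1r.
rewrite (bigD1 c) //= [X in _ * X]big1 => [|c' c'c]; last first.
  by rewrite big1 // => w _; rewrite is_parent_vcons eq_sym (negbTE c'c).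
rewrite mulr1 [RHS]big_mkcond; apply: eq_bigr => v _.
by rewrite is_parent_vcons eqxx !graft_vcons.
Qed.

(** [obs] hides the root of the subtree, but as a child of the larger tree that vertex is visible
    when [c < m]. *)
Definition child_obs (d t m k : nat) (c : 'I_d)
  (f : {ffun Vtx d t -> 'I_k}) : {ffun Vtx d t -> option 'I_k} :=
  [ffun w => if w == Defs.root d t then
     (if (c < m)%N then Some (f w) else None) else obs m f w].

Lemma obs_graft (d t m k : nat) (a : 'I_k)
  (f : {ffun 'I_d -> {ffun Vtx d t -> 'I_k}}) :
  obs m (graft a f) = graft None [ffun c => child_obs m c (f c)].
Proof.
apply: ffun_vtxS_ext => [|c v]; rewrite ?graft_root ?graft_vcons ffunE //.
rewrite graft_vcons revealed_vcons !ffunE; by case: eqP.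
Qed.

(** Law of the labels revealed in the subtree of child [c], given that the parent has label [i]. *)
Definition child_mu (R : realType) (k d t m : nat) (theta : R) (c : 'I_d)
  (i : 'I_k) (z : {ffun Vtx d t -> option 'I_k}) : R :=
  \sum_(f : {ffun Vtx d t -> 'I_k} | child_obs m c f == z)
     trans theta i (f (Defs.root d t)) * weight theta f.

(** Subtrees are conditionally independent given the root label; the root itself is hidden, so any
    other [y] has mass 0. *)
Lemma mu_graft (R : realType) (k d t m : nat) (theta : R) (i : 'I_k)
  (y : option 'I_k) (g : {ffun 'I_d -> {ffun Vtx d t -> option 'I_k}}) :
  mu m theta i (graft y g)
    = if y == None then \prod_c child_mu m theta c i (g c) else 0.
Proof.
rewrite /mu big_mkcond sum_graft (bigD1 i) //= [X in _ + X]big1 => [|a ai].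
  rewrite addr0; under eq_bigr do rewrite graft_root eqxx /= obs_graft eq_graft.
  case: y => [y|] /=; first by apply: big1.
  under [in RHS]eq_bigr do rewrite /child_mu big_mkcond.
  rewrite bigA_distr_bigA; apply: eq_bigr => f _.
  rewrite prod_if weight_graft; congr (if _ then _ else _).
  apply/eqP/forallP => [<- c|E]; first by rewrite ffunE.
  by apply/ffunP => c; rewrite ffunE; apply/eqP.
by rewrite big1 // => f _; rewrite graft_root (negbTE ai).
Qed.

(** Tensorization: [1 + chi2] is multiplicative over independent components. *)
Lemma sum_mu_sqr_div_graft (R : realType) (k d t m : nat) (theta : R)
  (i j : 'I_k) :
  \sum_(x : {ffun Vtx d t.+1 -> option 'I_k}) mu m theta i x ^+ 2 / mu m theta j x
  = \prod_(c < d) \sum_z child_mu (t := t) m theta c i z ^+ 2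
                          / child_mu m theta c j z.
Proof.
rewrite sum_graft (bigD1 None) //= [X in _ + X]big1 ?addr0 => [|y /negbTE yN].
  rewrite bigA_distr_bigA; apply: eq_bigr => g _.
  by rewrite !mu_graft /= prodf_div prodrXl.
by apply: big1 => g _; rewrite !mu_graft yN expr0n mul0r.
Qed.

(** * The copying kernel; total mass and support of the observed laws *)

Lemma trans_gt0 (R : realType) (k : nat) (theta : R) (a b : 'I_k) :
  0 < theta < 1 -> 0 < trans theta a b.
Proof.
case/andP=> th0 th1; have b0 : 0 < (1 - theta) / k%:R.
  by rewrite divr_gt0 ?subr_gt0 // ltr0n (leq_ltn_trans _ (ltn_ord a)).
by rewrite /trans; case: ifP => _ //; rewrite addr_gt0.
Qed.

(** The kernel is [theta] times the identity plus a uniform resampling; the uniform part forgets [a]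
    and cancels in differences. *)
Lemma sum_transM (R : realType) (k : nat) (theta : R) (a : 'I_k)
  (f : 'I_k -> R) :
  \sum_b trans theta a b * f b = theta * f a + (1 - theta) / k%:R * \sum_b f b.
Proof.
rewrite mulr_sumr (bigD1 a) //= [in RHS](bigD1 a) //= addrA; congr (_ + _).
  by rewrite /trans eqxx mulrDl.
by apply: eq_bigr => b /negbTE ba; rewrite /trans eq_sym ba.
Qed.

Lemma sum_trans (R : realType) (k : nat) (theta : R) (a : 'I_k) :
  \sum_b trans theta a b = 1.
Proof.
have k0 : k%:R != 0 :> R.
  by rewrite pnatr_eq0 -lt0n (leq_ltn_trans _ (ltn_ord a)).
under eq_bigr do rewrite -[trans _ _ _]mulr1.
rewrite sum_transM sumr_const card_ord; field; exact: k0.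
Qed.

(** Rows [i] and [j] differ only in columns [i] and [j], by [theta] up to sign. *)
Lemma chi2_trans (R : realType) (k : nat) (theta : R) (i j : 'I_k) :
  0 < theta < 1 -> i != j ->
  chi2 (trans theta i) (trans theta j)
    = theta ^+ 2 * ((theta + (1 - theta) / k%:R)^-1 + ((1 - theta) / k%:R)^-1).
Proof.
move=> th ij; rewrite -sum_sqr_sub_div ?sum_trans // => [|l]; last first.
  by move=> l0; have := trans_gt0 j l th; rewrite l0 ltxx.
rewrite (bigD1 i) //= (bigD1 j) ?(eq_sym j) //= [X in _ + (_ + X)]big1.
  by rewrite /trans !eqxx (negbTE ij) eq_sym (negbTE ij); ring.
move=> l /andP[li lj]; rewrite /trans ![_ == l]eq_sym (negbTE li) (negbTE lj).
by rewrite subrr expr0n mul0r.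
Qed.

Lemma weight_gt0 (R : realType) (k d t : nat) (theta : R)
  (f : {ffun Vtx d t -> 'I_k}) : 0 < theta < 1 -> 0 < weight theta f.
Proof.
by move=> th; apply: prodr_gt0 => u _; apply: prodr_gt0 => v _; apply: trans_gt0.
Qed.

Lemma sum_by_root (R : nmodType) (k d t : nat)
  (F : {ffun Vtx d t -> 'I_k} -> R) :
  \sum_f F f = \sum_l \sum_(f : {ffun Vtx d t -> 'I_k} | f (Defs.root d t) == l) F f.
Proof.
exact: (partition_big (fun f : {ffun Vtx d t -> 'I_k} => f (Defs.root d t)) predT).
Qed.

Lemma vtx0_root (d : nat) (v : Vtx d 0) : v = Defs.root d 0.
Proof.
apply/eqP; rewrite eq_root -size_eq0 /vseq size_tuple.
by case: (tag v) => -[].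
Qed.

Lemma sum_weight (R : realType) (k d t : nat) (theta : R) (i : 'I_k) :
  \sum_(f : {ffun Vtx d t -> 'I_k} | f (Defs.root d t) == i) weight theta f = 1.
Proof.
elim: t i => [|t IH] i.
  rewrite (big_pred1 [ffun => i]) => [|f].
    rewrite /weight big1 // => u _; rewrite big_pred0 // => v.
    by rewrite [v]vtx0_root is_parent_root.
  apply/eqP/eqP => [fi|->]; last by rewrite ffunE.
  by apply/ffunP => v; rewrite ffunE [v]vtx0_root.
rewrite big_mkcond sum_graft (bigD1 i) //= [X in _ + X]big1 => [|a ai].
  rewrite addr0; under eq_bigr do rewrite graft_root eqxx weight_graft.
  rewrite -(bigA_distr_bigA
    (fun (c : 'I_d) (f : {ffun Vtx d t -> 'I_k}) =>
       trans theta i (f (Defs.root d t)) * weight theta f)).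
  rewrite big1 // => c _; rewrite sum_by_root -(sum_trans theta i).
  apply: eq_bigr => l _; rewrite -[RHS]mulr1 -(IH l) mulr_sumr.
  by apply: eq_bigr => f /eqP ->.
by rewrite big1 // => f _; rewrite graft_root (negbTE ai).
Qed.

Lemma mu_ge0 (R : realType) (k d t m : nat) (theta : R) (i : 'I_k)
  (x : {ffun Vtx d t -> option 'I_k}) : 0 < theta < 1 -> 0 <= mu m theta i x.
Proof. by move=> th; apply: sumr_ge0 => f _; rewrite ltW ?weight_gt0. Qed.

Lemma sum_mu (R : realType) (k d t m : nat) (theta : R) (i : 'I_k) :
  \sum_(x : {ffun Vtx d t -> option 'I_k}) mu m theta i x = 1.
Proof. by rewrite -(sum_weight d t theta i) (partition_big (@obs d t m k) predT). Qed.

(* All labels are possible at the unrevealed root, so the support of the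
   observed law does not depend on the root label. *)
Lemma mu_eq0 (R : realType) (k d t m : nat) (theta : R) (i j : 'I_k)
  (x : {ffun Vtx d t -> option 'I_k}) :
  0 < theta < 1 -> mu m theta j x = 0 -> mu m theta i x = 0.
Proof.
move=> th mj; rewrite /mu big_pred0 // => f; apply/negP => /andP[_ /eqP fx].
pose g : {ffun Vtx d t -> 'I_k} :=
  [ffun v => if v == Defs.root d t then j else f v].
have gP : (g (Defs.root d t) == j) && (obs m g == x).
  rewrite ffunE !eqxx /= -fx; apply/eqP/ffunP => v; rewrite !ffunE.
  by case: eqP => [->|].
have : 0 < mu m theta j x.
  rewrite /mu (bigD1 g) //= ltr_pwDl ?weight_gt0 // sumr_ge0 // => h _.
  by rewrite ltW ?weight_gt0.
by rewrite mj ltxx.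
Qed.

Lemma mu_depth0 (R : realType) (k d m : nat) (theta : R) (i j : 'I_k)
  (x : {ffun Vtx d 0 -> option 'I_k}) : mu m theta i x = mu m theta j x.
Proof.
have obs0 (f : {ffun Vtx d 0 -> 'I_k}) : obs m f = [ffun => None].
  by apply/ffunP => v; rewrite !ffunE [v]vtx0_root.
rewrite /mu; under eq_bigl do rewrite obs0; under [RHS]eq_bigl do rewrite obs0.
case: eqP => _; last by rewrite !big_pred0 // => f; rewrite andbF.
by under eq_bigl do rewrite andbT; under [RHS]eq_bigl do rewrite andbT;
   rewrite !sum_weight.
Qed.

Lemma chi2_refl (R : realType) (X : finType) (p : X -> R) :
  \sum_x p x = 1 -> chi2 p p = 0.
Proof.
move=> p1; rewrite /chi2 -p1; apply/eqP; rewrite subr_eq0; apply/eqP.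
apply: eq_bigr => x _; have [->|px] := eqVneq (p x) 0.
  by rewrite invr0 mulr0.
by rewrite expr2 mulfK.
Qed.

(** * Bounds on the factor of one child *)

(* Data processing: the observed part of a child's subtree is no more
   informative about the parent than the child's own label. *)
Lemma child_factor_le (R : realType) (k d t m : nat) (theta : R) (c : 'I_d)
  (i j : 'I_k) : 0 < theta < 1 ->
  \sum_z child_mu (t := t) m theta c i z ^+ 2 / child_mu m theta c j z
    <= 1 + chi2 (trans theta i) (trans theta j).
Proof.
move=> th; rewrite [leRHS]addrC subrK.
pose a (l : 'I_k) (f : {ffun Vtx d t -> 'I_k}) :=
  trans theta l (f (Defs.root d t)) * weight theta f.
have a0 l f : 0 < a l f by rewrite mulr_gt0 ?trans_gt0 ?weight_gt0.
(* Titu on each fibre of [child_obs]: observing the full labeling can only increase the sum. *)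
apply: (@le_trans _ _ (\sum_f a i f ^+ 2 / a j f)).
  rewrite [leRHS](partition_big (@child_obs d t m k c) predT) //=.
  apply: ler_sum => z _; apply: sqr_sum_div_le => f _; first exact: ltW (a0 j f).
  by move=> aj; have := a0 j f; rewrite /a aj ltxx.
(* The subtree weight is common to both laws, so the likelihood ratio depends only on the child's
   label [l]. *)
rewrite sum_by_root; apply: ler_sum => l _.
rewrite -[leRHS]mulr1 -(sum_weight d t theta l) mulr_sumr.
apply: ler_sum => f /eqP fl; rewrite /a fl.
rewrite (_ : _ / _ = trans theta i l ^+ 2 / trans theta j l * weight theta f) //.
by field; rewrite !gt_eqF ?trans_gt0 ?weight_gt0.
Qed.

(** Below an unlabeled child the observation is that of a tree with hidden root, whose label is
    drawn by the kernel. *)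
Lemma child_mu_unlabeled (R : realType) (k d t m : nat) (theta : R) (c : 'I_d)
  (i : 'I_k) (z : {ffun Vtx d t -> option 'I_k}) : (m <= c)%N ->
  child_mu m theta c i z = \sum_l trans theta i l * mu m theta l z.
Proof.
move=> mc; have obsE (f : {ffun Vtx d t -> 'I_k}) : child_obs m c f = obs m f.
  apply/ffunP => v; rewrite ffunE; case: eqP => // ->.
  by rewrite ltnNge mc ffunE.
rewrite /child_mu big_mkcond sum_by_root; apply: eq_bigr => l _.
rewrite /mu mulr_sumr big_mkcondr; apply: eq_bigr => f /eqP <-.
by rewrite obsE; case: eqP; rewrite // mulr0.
Qed.

(** Titu splits the mixture in the denominator into its components [P l]; the constant 4 is the 2 of
    [(u - v)^2 <= 2 u^2 + 2 v^2] times the two divergences from [P l]. *)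
Lemma chi2_mixture_le (R : realType) (X : finType) (k : nat) (theta h : R)
  (P N : 'I_k -> X -> R) (i j : 'I_k) :
  0 < theta < 1 -> (forall l x, 0 <= P l x) -> (forall l, \sum_x P l x = 1) ->
  (forall l l' x, P l' x = 0 -> P l x = 0) ->
  (forall l l', chi2 (P l) (P l') <= h) ->
  (forall l x, N l x = \sum_l' trans theta l l' * P l' x) ->
  \sum_x N i x ^+ 2 / N j x <= 1 + 4 * theta ^+ 2 * h.
Proof.
move=> th P0 P1 ac hP NE.
have N1 l : \sum_x N l x = 1.
  under eq_bigr do rewrite NE.
  rewrite exchange_big /= -(sum_trans theta l); apply: eq_bigr => l' _.
  by rewrite -mulr_sumr P1 mulr1.
have N0 l' x : N l' x = 0 -> forall l, P l x = 0.
  rewrite NE => /eqP; rewrite psumr_eq0 => [/allP/(_ l' (mem_index_enum l'))/eqP|l _].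
    move=> /eqP; rewrite mulf_eq0 gt_eqF ?trans_gt0 //= => /eqP Pl l.
    exact: ac Pl.
  by rewrite mulr_ge0 // ltW ?trans_gt0.
have NB x : N i x - N j x = theta * (P i x - P j x).
  by rewrite !NE !sum_transM; ring.
rewrite -lerBlDl -/(chi2 (N i) (N j)) -sum_sqr_sub_div ?N1 //; last first.
  by move=> x /N0 N0x; rewrite NE big1 // => l _; rewrite N0x mulr0.
pose q l l' x := (P l x - P l' x) ^+ 2 / P l' x.
apply: (@le_trans _ _ (\sum_x \sum_l
  trans theta j l * (theta ^+ 2 * (2 * (q i l x + q j l x))))).
  apply: ler_sum => x _.
  have -> : N i x - N j x = \sum_l trans theta j l * (N i x - N j x).
    by rewrite -mulr_suml sum_trans mul1r.
  rewrite [X in _ / X <= _]NE; apply: le_trans (sqr_sum_div_le _ _) _ => [l _|l _|].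
  - by rewrite mulr_ge0 // ltW ?trans_gt0.
  - move=> /eqP; rewrite mulf_eq0 gt_eqF ?trans_gt0 //= => /eqP Pl.
    by rewrite NB (ac i l) // (ac j l) // subrr !mulr0.
  - apply: ler_sum => l _; rewrite NB.
    have T0 := trans_gt0 j l th.
    rewrite exprMn invfM mulrACA expr2 mulfK ?gt_eqF // -mulrA.
    rewrite ler_wpM2l ?(ltW T0) // mulrA -expr2 exprMn -mulrA ler_wpM2l ?sqr_ge0 //.
    rewrite /q -mulrDl mulrA ler_wpM2r ?invr_ge0 //.
    (* Parallelogram identity with [u = P i x - P l x] and [v = P j x - P l x]. *)
    have := sqr_ge0 (P i x - P l x + (P j x - P l x)); nra.
rewrite exchange_big /=.
have -> : 4 * theta ^+ 2 * h
    = \sum_l trans theta j l * (4 * theta ^+ 2 * h).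
  by rewrite -mulr_suml sum_trans mul1r.
apply: ler_sum => l _; rewrite -mulr_sumr ler_wpM2l //; first by rewrite ltW ?trans_gt0.
rewrite -!mulr_sumr big_split /=.
rewrite !sum_sqr_sub_div //; try by move=> x; apply: ac.
have -> : 4 * theta ^+ 2 * h = theta ^+ 2 * (2 * (h + h)) by ring.
by rewrite ler_wpM2l ?sqr_ge0 // ler_wpM2l // lerD.
Qed.

(** * The recursion in depth and its consequences *)

Lemma sum_ord_split (R : pzRingType) (d m : nat) (a b : R) : (m <= d)%N ->
  \sum_(c < d) (if (c < m)%N then a else b) = m%:R * a + (d%:R - m%:R) * b.
Proof.
move=> md; rewrite (bigID (fun c : 'I_d => (c < m)%N)) /=; congr (_ + _).
  rewrite (eq_bigr (fun => a)) => [|c ->] //.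
  by rewrite -(big_ord_widen d (fun => a)) // sumr_const card_ord mulr_natl.
rewrite (eq_bigr (fun => b)) => [|c /negbTE ->] //.
have : \sum_(c < d) b = \sum_(c < d | (c < m)%N) b + \sum_(c < d | ~~ (c < m)%N) b.
  by rewrite [LHS](bigID (fun c : 'I_d => (c < m)%N)).
rewrite -(big_ord_widen d (fun => b)) // !sumr_const !card_ord => E.
by rewrite mulrBl !mulr_natl E addrAC subrr add0r.
Qed.

(** Since [y < D], replacing [y^2] by [y D] and [y^3] by [y D^2] in the cubic bound for [expR y]
    bounds the left-hand side by [y (1 - D^3 / 2)]. *)
Lemma recursion_fixpoint_le (R : realType) (D y : R) : 0 <= y < D -> D <= 1 ->
  y * D / 2 + (1 - D) * (expR y - 1) <= y.
Proof.
move=> /andP[y0 yD] D1; have D0 : 0 < D by apply: le_lt_trans yD.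
have e : expR y - 1 <= y * (1 + D / 2 + D ^+ 2 / 2).
  have : expR y <= 1 + y + y ^+ 2 / 2 + y ^+ 3 / 2.
    by apply: expR_le_cubic; rewrite y0 /=; lra.
  have y2 : y ^+ 2 <= y * D by rewrite expr2 ler_wpM2l // ltW.
  have y3 : y ^+ 3 <= y * D ^+ 2.
    rewrite [y ^+ 3]exprS ler_wpM2l // lerXn2r ?nnegrE //; exact: ltW.
  lra.
have : (1 - D) * (expR y - 1) <= (1 - D) * (y * (1 + D / 2 + D ^+ 2 / 2)).
  by apply: ler_wpM2l => //; rewrite subr_ge0.
have : 0 <= y * D ^+ 3 by rewrite mulr_ge0 // exprn_ge0 // ltW.
lra.
Qed.

Lemma chi2_mu_le (R : realType) (k d m t : nat) (theta L D y : R) (i j : 'I_k) :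
  0 < theta < 1 -> (m <= d)%N -> D <= 1 -> 0 <= y < D ->
  1 + theta ^+ 2 * ((theta + (1 - theta) / k%:R)^-1 + ((1 - theta) / k%:R)^-1)
    = expR L ->
  (d%:R - m%:R) * (4 * theta ^+ 2) = 1 - D -> m%:R * L = y * D / 2 ->
  1 + chi2 (@mu R k d t m theta i) (@mu R k d t m theta j) <= expR y.
Proof.
move=> th md D1 yD LE DE yE; have /andP[y0 _] := yD.
elim: t i j => [|t IH] i j.
  have -> : chi2 (@mu R k d 0 m theta i) (@mu R k d 0 m theta j) = 0.
    rewrite -(chi2_refl (sum_mu d 0 m theta j)) /chi2.
    by under eq_bigr do rewrite (mu_depth0 _ _ i j).
  by rewrite addr0 -expR0 ler_expR.
(* The formula of [chi2_trans] holds for distinct labels only. *)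
have [<-|ij] := eqVneq i j.
  by rewrite chi2_refl ?sum_mu // addr0 -expR0 ler_expR.
rewrite /chi2 addrC subrK sum_mu_sqr_div_graft.
pose h := expR y - 1.
apply: (@le_trans _ _ (expR (\sum_(c < d)
  if (c < m)%N then L else 4 * theta ^+ 2 * h))).
  rewrite expR_sum; apply: ler_prod => c _; apply/andP; split.
    apply: sumr_ge0 => z _; rewrite divr_ge0 ?sqr_ge0 // sumr_ge0 // => f _.
    by rewrite mulr_ge0 // ltW ?trans_gt0 ?weight_gt0.
  case: ltnP => cm; first by rewrite -LE -(chi2_trans th ij) child_factor_le.
  (* The inequality [1 + x <= expR x] moves the factor of an unlabeled child into the exponent. *)
  apply: le_trans (expR_ge1Dx _).
  apply: (@chi2_mixture_le _ _ _ _ _ (@mu R k d t m theta)) => //.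
  - by move=> l x; apply: mu_ge0.
  - by move=> l; apply: sum_mu.
  - by move=> l l' x; apply: mu_eq0.
  - by move=> l l'; rewrite lerBrDl IH.
  - by move=> l x; apply: child_mu_unlabeled.
rewrite ler_expR sum_ord_split // yE mulrA DE.
exact: recursion_fixpoint_le.
Qed.

Theorem theorem6 (R : realType) (k d m t : nat) (theta delta : R) :
  (0 < k)%N -> 0 < theta < 1 -> 0 <= delta <= 1 ->
  delta * d%:R = m%:R -> (0 < t)%N ->
  1 < delta * d%:R ->
  (1 - delta) * theta ^+ 2 * d%:R < 1 / 4 ->
  let L := ln (1 + theta ^+ 2 * ((theta + (1 - theta) / k%:R)^-1
                                  + ((1 - theta) / k%:R)^-1)) in
  let D := 1 - 4 * (1 - delta) * theta ^+ 2 * d%:R in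
  let C := 2 * delta * theta ^+ 2 * d%:R / D
           * ((1 - theta)^-1 + (k%:R * theta + 1 - theta)^-1) in
  2 * delta * d%:R * L < D ^+ 2 ->
  (forall i j : 'I_k,
     ln (1 + chi2 (@mu R k d t m theta i) (@mu R k d t m theta j)) <= 2 * delta * d%:R * L / D)
  /\ 2 * delta * d%:R * L / D <= k%:R * C
  /\ (forall Phi : {ffun Vtx d t -> option 'I_k} -> 'I_k,
        1 / 2 * (1 - C - 1 / k%:R) <= \big[Num.max/0]_(i < k) err m theta Phi i).
Proof.
move=> k0 th /andP[dl0 dl1] dm _ _ small L D C LD.
have /andP[th0 th1] := th.
have kR : 0 < k%:R :> R by rewrite ltr0n.
set x := theta ^+ 2 * _ in L LD *.
have b0 : 0 < (1 - theta) / k%:R by rewrite divr_gt0 ?subr_gt0.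
have a0 : 0 < theta + (1 - theta) / k%:R by rewrite addr_gt0.
have x0 : 0 < x by rewrite mulr_gt0 ?exprn_gt0 // addr_gt0 ?invr_gt0.
have LE : 1 + x = expR L by rewrite lnK // posrE addr_gt0.
have L0 : 0 <= L by rewrite ln_ge0 // lerDl ltW.
have Lx : L <= x by rewrite le_ln1Dx // (lt_trans _ x0) // ltrN10.
have dR : 0 <= d%:R :> R by [].
have md : (m <= d)%N by rewrite -(ler_nat R) -dm ler_piMl.
have D0 : 0 < D by rewrite /D; lra.
have D1 : D <= 1.
  have dl1' : 0 <= 1 - delta by rewrite subr_ge0.
  by rewrite /D lerBlDr lerDl !mulr_ge0 ?(ltW th0).
pose y := 2 * delta * d%:R * L / D.
have y0 : 0 <= y by rewrite divr_ge0 ?(ltW D0) // !mulr_ge0.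
(* After division by [D], this is the hypothesis [LD]. *)
have yD : y < D by rewrite ltr_pdivrMr // -expr2.
have chiE (i j : 'I_k) :
    1 + chi2 (@mu R k d t m theta i) (@mu R k d t m theta j) <= expR y.
  apply: (chi2_mu_le t i j th md D1 _ LE); first by rewrite y0.
    by rewrite -dm /D; ring.
  by rewrite -dm /y; field; rewrite gt_eqF.
have ac (i j : 'I_k) (z : {ffun Vtx d t -> option 'I_k}) :
    mu m theta j z = 0 -> mu m theta i z = 0 by apply: mu_eq0.
have yC : y <= k%:R * C.
  (* [k C] is [y] with [L = ln (1 + x)] replaced by its upper bound [x]. *)
  have -> : k%:R * C = 2 * delta * d%:R * x / D.
    rewrite /C /x; field.
    by rewrite !gt_eqF ?subr_gt0 //; nra.
  by rewrite ler_wpM2r ?invr_ge0 ?(ltW D0) // ler_wpM2l // !mulr_ge0.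
split=> [i j|]; last split=> // Phi.
  rewrite -/y -(expRK y) ler_ln ?posrE ?expR_gt0 // ltr_pwDl //.
  rewrite -sum_sqr_sub_div ?sum_mu //; last by move=> z; apply: ac.
  by apply: sumr_ge0 => z _; rewrite divr_ge0 ?sqr_ge0 ?mu_ge0.
set M := \big[_/_]_(i < k) _.
have chi2y (i j : 'I_k) :
    chi2 (@mu R k d t m theta i) (@mu R k d t m theta j) <= 2 * y.
  have y1 : y <= 1 by rewrite ltW // (lt_le_trans yD).
  have e : expR y <= 1 + y + y ^+ 2 / 2 + y ^+ 3 / 2.
    by apply: expR_le_cubic; rewrite y0.
  have y2 : y ^+ 2 <= y by rewrite expr2 ler_piMl.
  have y3 : y ^+ 3 <= y ^+ 2 by rewrite [y ^+ 3]exprS ler_piMl ?sqr_ge0.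
  have := chiE i j; lra.
have : (k%:R - 1 - y) / 2 <= \sum_(i < k) err m theta Phi i.
  apply: sum_error_ge => //.
  - by rewrite y0 ltW // (lt_le_trans yD).
  - by move=> i z; apply: mu_ge0.
  - by move=> i; apply: sum_mu.
(* The worst error is at least the average over a uniform root label. *)
have : \sum_(i < k) err m theta Phi i <= k%:R * M.
  rewrite mulr_natl -[X in M *+ X]card_ord -sumr_const.
  by apply: ler_sum => i _; apply: le_bigmax.
move=> h1 h2; rewrite -(ler_pM2l kR).
have -> : k%:R * (1 / 2 * (1 - C - 1 / k%:R)) = (k%:R - k%:R * C - 1) / 2.
  by field; rewrite gt_eqF.
lra.
Qed.
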